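(* Let $d\ge1$ and let $\{x_n\}_{n\ge1}$ be the LISA process in $\mathbb{R}^d$ defined by an initial configuration $x_1,\dots,x_{n_0}$ and $$x_{n+1}=x_{\chi_n}+d_n(x_{\chi_n})\,\psi_{n+1},\qquad n=n_0,n_0+1,\dots,$$ as described in the context. Put $\eta_n=\|\psi_n\|$, $\hat\eta_n=\min\{\eta_n,1\}$, $C=\mathbf{E}\eta_1$, $\hat C=\mathbf{E}\hat\eta_1$. If $C+\hat C<1$, then $\sup_n\|x_n\|<\infty$ almost surely. Moreover, $$\mathbf{E}\sup_n\|x_n\|\le A_0+\frac{n_0D_0C}{1-\hat C-C}$$ for some constants $A_0,D_0$ depending only on the initial configuration $\{x_1,\dots,x_{n_0}\}$.
   Context: The initial configuration consists of $n_0\ge2$ fixed distinct points $x_1,\dots,x_{n_0}\in\mathbb{R}^d$. The random variables $\chi_n$ ($n\ge n_0$) are independent, with $\chi_n$ uniform on $\{1,\dots,n\}$; $\{\psi_n\}$ are i.i.d. $\mathbb{R}^d$-valued random vectors with an arbitrary given distribution; the sequences $\{\chi_n\}$ and $\{\psi_n\}$ are independent of each other. For $1\le k\le n$, $d_n(x_k)=\min\{\|x_k-x_j\|:1\le j\le n,\ j\neq k\}$ is the distance from the particle $x_k$ to the nearest other particle present after $n$ particles have been placed (collections of particles are counted with multiplicity). $\|\cdot\|$ is the Euclidean norm. *)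

(* Defs.v *)
From mathcomp Require Export all_boot all_order all_algebra finmap.
From mathcomp Require Export all_classical all_reals all_analysis.

Set Implicit Arguments.
Unset Strict Implicit.
Unset Printing Implicit Defensive.

Import Order.TTheory GRing.Theory Num.Theory.
Import numFieldNormedType.Exports.

Local Open Scope classical_set_scope.
Local Open Scope ring_scope.

(* Euclidean norm; the library's norm on row vectors is the sup norm. *)
Definition enorm (R : realType) (d : nat) (v : 'rV[R]_d) : R :=
  Num.sqrt (\sum_(i < d) v 0 i ^+ 2).

Definition borel (T : topologicalType) : set_system T := <<s @open T >>.

Section Independence.
Context (disp : measure_display) (Omega : measurableType disp) (R : realType).
Variable P : probability Omega R.

Definition independent2 (F G : set_system Omega) : Prop :=
  forall A B, F A -> G B -> P (A `&` B) = (P A * P B)%E.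

Definition mutually_independent (I : set nat) (F : nat -> set_system Omega) :
    Prop :=
  forall (s : {fset nat}) (E : nat -> set Omega),
    [set` s] `<=` I -> (forall i, i \in s -> F i (E i)) ->
    P (\bigcap_(i in [set` s]) E i) = (\prod_(i <- s) P (E i))%E.

End Independence.

Definition sigma_nat (Omega : Type) (chi : Omega -> nat) : set_system Omega :=
  preimage_set_system [set: Omega] chi measurable.

Definition sigma_vec (Omega : Type) (R : realType) (d : nat)
    (psi : Omega -> 'rV[R]_d) : set_system Omega :=
  preimage_set_system [set: Omega] psi (@borel 'rV[R]_d).

Definition sigma_join (Omega : Type) (I : set nat)
    (F : nat -> set_system Omega) : set_system Omega :=
  <<s \bigcup_(i in I) F i >>.

(* Distance from x_k to the nearest other particle among x_1, ..., x_n.  The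
   exclusion j != k is on indices, so coinciding particles are at distance 0.
   The list is nonempty for n >= 2; starting the minimum from its head does not
   change the result. *)
Definition nearest_dist (R : realType) (d : nat) (x : nat -> 'rV[R]_d)
    (n k : nat) : R :=
  let s := [seq enorm (x k - x j) | j <- iota 1 n & j != k] in
  \big[Num.min/head 0 s]_(r <- s) r.

(* Random inputs: chi_n for n >= n0, psi_n for n >= 1; the values of chi and psi
   at other indices are irrelevant. *)
Record lisa_inputs (disp : measure_display) (Omega : measurableType disp)
    (R : realType) (P : probability Omega R) (d n0 : nat)
    (chi : nat -> Omega -> nat) (psi : nat -> Omega -> 'rV[R]_d) : Prop := {
  chi_measurable : forall n, (n0 <= n)%N -> measurable_fun setT (chi n);
  chi_range : forall n w, (n0 <= n)%N -> (1 <= chi n w <= n)%N;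
  chi_uniform : forall n k, (n0 <= n)%N -> (1 <= k <= n)%N ->
    P [set w | chi n w = k] = (n%:R^-1)%:E;
  chi_independent : mutually_independent P [set n | (n0 <= n)%N]
    (fun n => sigma_nat (chi n));
  psi_measurable : forall n B, (1 <= n)%N -> borel B ->
    measurable (psi n @^-1` B);
  psi_identically_distributed : forall n B, (1 <= n)%N -> borel B ->
    P (psi n @^-1` B) = P (psi 1%N @^-1` B);
  psi_independent : mutually_independent P [set n | (1 <= n)%N]
    (fun n => sigma_vec (psi n));
  chi_psi_independent : independent2 P
    (sigma_join [set n | (n0 <= n)%N] (fun n => sigma_nat (chi n)))
    (sigma_join [set n | (1 <= n)%N] (fun n => sigma_vec (psi n))) }.

(* The initial configuration is x_1 = conf 0, ..., x_n0 = conf (n0 - 1); the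
   value x 0 is not part of the process. *)
Record lisa_process (Omega : Type) (R : realType) (d n0 : nat)
    (conf : 'I_n0 -> 'rV[R]_d)
    (chi : nat -> Omega -> nat) (psi : nat -> Omega -> 'rV[R]_d)
    (x : nat -> Omega -> 'rV[R]_d) : Prop := {
  lisa_initial : forall (i : 'I_n0) w, x i.+1 w = conf i;
  lisa_step : forall n w, (n0 <= n)%N ->
    x n.+1 w = x (chi n w) w
      + nearest_dist (fun j => x j w) n (chi n w) *: psi n.+1 w }.

Definition sup_norm (Omega : Type) (R : realType) (d : nat)
    (x : nat -> Omega -> 'rV[R]_d) (w : Omega) : \bar R :=
  ereal_sup [set (enorm (x n w))%:E | n in [set n | (1 <= n)%N]].

(* Main.v *)
From HB Require Import structures.
Require Import Defs.
From mathcomp Require Import all_boot all_order all_algebra.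
From mathcomp Require Import all_classical all_reals all_analysis.
From mathcomp Require Import measurable_realfun ring lra.

Set Implicit Arguments.
Unset Strict Implicit.
Unset Printing Implicit Defensive.
Import Order.TTheory GRing.Theory Num.Theory.
Import numFieldNormedType.Exports.
Local Open Scope classical_set_scope.
Local Open Scope ring_scope.

(** Write gap_n(k) for the distance d_n(x_k), S_n for the sum of gap_n(k) over
    k <= n, and D_n = gap_n(chi_n) for the gap of the particle chosen as parent
    of x_{n+1}.

    The new particle is at distance D_n eta_{n+1} from its parent.  Hence its
    own gap is at most D_n eta_{n+1}, the gap of the parent drops from D_n to at
    most D_n min(eta_{n+1}, 1), and no other gap grows.  This gives, for every
    outcome, S_{n+1} + D_n <= S_n + D_n min(eta_{n+1}, 1) + D_n eta_{n+1}
    ([sum_nearest_distS]).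

    In expectation, chi_n is uniform and independent of the configuration of the
    first n particles, so E D_n = E S_n / n ([expected_parent_gap]); and
    psi_{n+1} is independent of D_n, so the two products have means (E D_n) C^
    and (E D_n) C ([expected_parent_gapM]).  Therefore
      (1 - C^ - C) E S_n / n <= E S_n - E S_{n+1},
    and the right-hand sides telescope: the sum over n >= n_0 of E S_n / n is at
    most S_{n_0} / (1 - C^ - C) ([sum_expected_gap]).

    Following ancestors back to the initial configuration, every particle
    has norm at most A_0 plus the sum over all n >= n_0 of the displacements
    D_n eta_{n+1} ([enorm_position_le]).  The expectation of this random
    series is C times the sum of the E S_n / n, which bounds E sup |x_n|; being
    integrable, the series is almost surely finite ([expected_sup_norm]).  The
    constants are A_0 = the sum of the norms of the initial particles and
    D_0 = S_{n_0} / n_0, the mean initial gap.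

    The probabilistic input is the independence of the sigma-algebra of the past
    from chi_n and from psi_{n+1} ([independent_history_chi],
    [independent_history_psi]), deduced from the hypotheses by the pi-lambda
    theorem, together with the fact that the positions are measurable
    functions of the past ([measurable_position_history]). *)

(** * Independence of generated sigma-algebras *)

Section IndependentSigmaAlgebras.
Context (disp : measure_display) (Omega : measurableType disp) (R : realType).
Variable P : probability Omega R.
Implicit Types F G H U : set_system Omega.

Lemma sigma_algebra_setT F : sigma_algebra setT F -> F setT.
Proof. by case=> F0 FC _; rewrite -(setD0 setT); exact: FC. Qed.

Lemma sigma_algebra_setI_closed F : sigma_algebra setT F -> setI_closed F.
Proof.
move=> sF A B; rewrite -(measurable_g_measurableTypeE sF).
exact: (@measurableI _ (g_sigma_algebraType F)).
Qed.

(** For a fixed event B, the finite measures A |-> P (A `&` B) and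
    A |-> P A * P B agree on the pi-system G, hence on the sigma-algebra that it
    generates. *)
Lemma independent2_pi_system G U :
  G `<=` measurable -> U `<=` measurable -> setI_closed G -> G setT ->
  independent2 P G U -> independent2 P <<s G >> U.
Proof.
move=> mG mU GI GT GU A B sGA UB.
have mB : measurable B := mU _ UB.
pose c : {nonneg R} := NngNum (fine_ge0 (measure_ge0 P B)).
pose m1 := mrestr P mB; pose m2 := mscale c P.
have PB : (c%:num)%:E = P B by rewrite /c /= fineK ?fin_num_measure.
suff : m1 A = m2 A.
  by move=> m12; rewrite -[LHS]/(m1 A) m12 -[LHS]/(_ * _)%E PB muleC.
apply: (@g_sigma_algebra_measure_unique _ _ _ G mG (fun=> setT) _ _ m1 m2)
  => //.
- by apply/seteqP; split => // x _; exists 0%N.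
- by move=> E GE; rewrite -[LHS]/(P _) -[RHS]/(_ * _)%E PB muleC GU.
- by move=> k; rewrite -[ltLHS]/(P _) setTI ltey_eq fin_num_measure.
Qed.

(** The finite intersections of events taken from the F i, i in J, form a
    pi-system generating the join, and on them independence from F a is an
    instance of mutual independence, for the index set extended by a. *)
Lemma independent2_sigma_join (I J : set nat) (a : nat)
    (F : nat -> set_system Omega) :
  (forall i, sigma_algebra setT (F i)) ->
  (forall i, I i -> F i `<=` measurable) ->
  mutually_independent P I F -> J `<=` I -> I a -> ~ J a ->
  independent2 P (sigma_join J F) (F a).
Proof.
move=> sF mF indF JI Ia nJa.
have FT i : F i setT by exact: sigma_algebra_setT.
have FI i : setI_closed (F i) by exact: sigma_algebra_setI_closed.
pose G := [set A | exists (s : {fset nat}) (E : nat -> set Omega),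
  [/\ [set` s] `<=` J, (forall i, F i (E i)) &
      A = \bigcap_(i in [set` s]) E i]].
have mG : G `<=` measurable.
  move=> _ [s [E [sJ FE ->]]]; apply: fin_bigcap_measurable => // i si.
  by apply: (mF i) => //; apply/JI/sJ.
have GI : setI_closed G.
  move=> _ _ [s [E [sJ FE ->]]] [t [E' [tJ FE' ->]]].
  (* The two families are padded with the full set outside s and t, so that both
     range over the union of s and t. *)
  exists (s `|` t)%fset, (fun i => (if i \in s then E i else setT) `&`
    (if i \in t then E' i else setT)); split.
  - by move=> i /=; rewrite inE => /orP[/sJ|/tJ].
  - by move=> i; apply: FI; case: ifP.
  - apply/seteqP; split => w /=.
      move=> [sw tw] i _; split; case: ifP => //.
        by move=> si; apply: sw.
      by move=> ti; apply: tw.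
    move=> stw; split => i /= si.
      by have [] := stw i; rewrite /= ?inE ?si.
    by have [] := stw i; rewrite /= ?inE ?si ?orbT.
have GT : G setT.
  exists fset0, (fun=> setT); split => //.
  by rewrite bigcapT.
have GFa : independent2 P G (F a).
  move=> _ B [s [E [sJ FE ->]]] FB.
  have aNs : a \notin s by apply/negP => /sJ.
  pose E' i := if i == a then B else E i.
  have E'E i : i \in s -> E' i = E i.
    by rewrite /E'; case: eqP => // ->; rewrite (negbTE aNs).
  have -> : \bigcap_(i in [set` s]) E i `&` B =
      \bigcap_(i in [set` (a |` s)%fset]) E' i.
    apply/seteqP; split => w /=.
      move=> [sw Bw] i /=; rewrite !inE /E'; case: eqP => //= _ si.
      exact: sw.
    move=> saw; split.
      by move=> i /= si; rewrite -E'E//; apply: saw; rewrite /= !inE si orbT.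
    by have := saw a; rewrite /= !inE eqxx /E' eqxx; exact.
  rewrite indF; last 2 first.
  - by move=> i /=; rewrite !inE => /orP[/eqP->//|/sJ/JI].
  - by move=> i _; rewrite /E'; case: eqP => // ->.
  rewrite big_fsetU1//= {1}/E' eqxx muleC; congr (_ * _)%E.
  rewrite indF//; last by move=> i /sJ/JI.
  by apply: eq_big_seq => i si; rewrite E'E.
have := independent2_pi_system mG (mF _ Ia) GI GT GFa.
have -> // : <<s G >> = sigma_join J F.
apply/seteqP; split; apply: smallest_sub.
- exact: smallest_sigma_algebra.
- move=> _ [s [E [sJ FE ->]]].
  have -> : \bigcap_(i in [set` s]) E i = \big[setI/setT]_(i <- s) E i.
    by rewrite bigcap_fset.
  rewrite big_seq; elim/big_ind : _ => //.
  - by apply: sigma_algebra_setT; exact: smallest_sigma_algebra.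
  - by apply: sigma_algebra_setI_closed; exact: smallest_sigma_algebra.
  - move=> i si; apply: sub_sigma_algebra; exists i => //; exact: sJ.
- exact: smallest_sigma_algebra.
- move=> A [i Ji FA]; apply: sub_sigma_algebra.
  exists [fset i]%fset, (fun j => if j == i then A else setT); split.
  + by move=> j /=; rewrite inE => /eqP ->.
  + by move=> j; case: eqP => // ->.
  + apply/seteqP; split => w /=.
      by move=> Aw j /=; rewrite inE => /eqP->; rewrite eqxx.
    by move/(_ i); rewrite /= inE eqxx; exact.
Qed.

(** If U is independent of F' and both are contained in an F independent of H,
    then adding to F' events of H keeps it independent of U: for A in F', B in H'
    and V in U, since A `&` V is again in F, the probability of A `&` B `&` V is
    P (A `&` V) * P B = P A * P B * P V. *)
Lemma independent2_join_left (F F' H H' U : set_system Omega) :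
  F `<=` measurable -> H `<=` measurable -> setI_closed F ->
  F' `<=` F -> U `<=` F -> H' `<=` H ->
  sigma_algebra setT F' -> sigma_algebra setT H' ->
  independent2 P F H -> independent2 P F' U ->
  independent2 P <<s F' `|` H' >> U.
Proof.
move=> mF mH FI F'F UF H'H sF' sH' FH F'U.
pose G := [set A `&` B | A in F' & B in H'].
have sGU : <<s F' `|` H' >> `<=` <<s G >>.
  apply: smallest_sub; first exact: smallest_sigma_algebra.
  move=> A [FA|HA]; apply: sub_sigma_algebra.
    by exists A => //; exists setT; [exact: sigma_algebra_setT|rewrite setIT].
  by exists setT; [exact: sigma_algebra_setT|exists A => //; rewrite setTI].
suff : independent2 P <<s G >> U by move=> GU A B /sGU; exact: GU.
apply: independent2_pi_system.
- move=> _ [A FA [B HB <-]]; apply: measurableI; first exact/mF/F'F.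
  exact/mH/H'H.
- by move=> A /UF/mF.
- move=> _ _ [A FA [B HB <-]] [A' FA' [B' HB' <-]].
  exists (A `&` A'); first exact: sigma_algebra_setI_closed.
  by exists (B `&` B'); [exact: sigma_algebra_setI_closed|rewrite setIACA].
- exists setT; first exact: sigma_algebra_setT.
  by exists setT; [exact: sigma_algebra_setT|rewrite setIT].
- move=> _ V [A FA [B HB <-]] UV.
  rewrite setIAC FH; last 2 first.
  + by apply: FI; [exact: F'F|exact: UF].
  + exact: H'H.
  by rewrite F'U// FH//; [rewrite muleAC|exact: F'F|exact: H'H].
Qed.

End IndependentSigmaAlgebras.

(** * Expectation of products *)

(** A nonnegative random variable is integrated through its law by means of the
    positive part, a nonnegative integrand on the whole real line that coincides
    with the identity on the values taken. *)
Lemma ge0_expectation_distribution (disp : measure_display)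
    (Omega : measurableType disp) (R : realType) (P : probability Omega R)
    (X : {RV P >-> R}) : (forall w, 0 <= X w) ->
  (\int[distribution P X]_r (Num.max r 0)%:E = \int[P]_w (X w)%:E)%E.
Proof.
move=> X0; rewrite ge0_integral_distribution//.
- by apply: eq_integral => w _; rewrite /= (max_idPl (X0 w)).
- by apply/measurable_EFinP; exact: measurable_maxr.
- by move=> r; rewrite lee_fin le_max lexx orbT.
Qed.

Section ExpectationOfProduct.
Context (disp : measure_display) (Omega : measurableType disp) (R : realType).
Variable P : probability Omega R.
Variables f g : Omega -> R.
Hypotheses (mf : measurable_fun setT f) (mg : measurable_fun setT g).

Let f_mixin := isMeasurableFun.Build _ _ _ _ _ mf.
Let X : {RV P >-> R} := HB.pack f f_mixin.
Let g_mixin := isMeasurableFun.Build _ _ _ _ _ mg.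
Let Y : {RV P >-> R} := HB.pack g g_mixin.
Let fg w := (f w, g w).
Let mfg : measurable_fun setT fg. Proof. exact: measurable_fun_pair. Qed.
Let fg_mixin := isMeasurableFun.Build _ _ _ _ _ mfg.
Let XY : {RV P >-> (R * R)%type} := HB.pack fg fg_mixin.

(** Independence says that the joint law of f and g is the product of their
    laws, so the formula is Tonelli's theorem for (r, s) |-> r * s. *)
Lemma ge0_expectationM_indep :
  (forall w, 0 <= f w) -> (forall w, 0 <= g w) ->
  (forall A B : set R, measurable A -> measurable B ->
    P (f @^-1` A `&` g @^-1` B) = (P (f @^-1` A) * P (g @^-1` B))%E) ->
  (\int[P]_w (f w * g w)%:E = \int[P]_w (f w)%:E * \int[P]_w (g w)%:E)%E.
Proof.
move=> f0 g0 fgind.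
pose n (x : R) := (Num.max x 0)%:E.
have mn : measurable_fun setT n.
  by apply/measurable_EFinP; exact: measurable_maxr.
have n0 x : (0 <= n x)%E by rewrite lee_fin le_max lexx orbT.
pose h (z : R * R) := (n z.1 * n z.2)%E.
have mh : measurable_fun setT h.
  by apply: emeasurable_funM; exact: measurableT_comp.
have h0 z : (0 <= h z)%E by exact: mule_ge0.
transitivity (\int[distribution P XY]_z h z)%E.
  rewrite ge0_integral_distribution//; apply: eq_integral => w _.
  by rewrite /h /n /= (max_idPl (f0 w)) (max_idPl (g0 w)).
transitivity (\int[distribution P X \x distribution P Y]_z h z)%E.
  apply: eq_measure_integral => A mA _; apply/esym.
  by apply: (product_measure_unique _ mA) => B B' mB mB'; exact: fgind.
have -> : (\int[P]_w (f w)%:E = \int[distribution P X]_r n r)%E.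
  by rewrite -(ge0_expectation_distribution (X := X) f0).
have -> : (\int[P]_w (g w)%:E = \int[distribution P Y]_r n r)%E.
  by rewrite -(ge0_expectation_distribution (X := Y) g0).
rewrite fubini_tonelli1//.
rewrite muleC -ge0_integralZl//; last by apply: integral_ge0.
apply: eq_integral => x _.
by rewrite /fubini_F /h /= ge0_integralZl// muleC.
Qed.

End ExpectationOfProduct.

Lemma ge0_expectation_same_law (disp : measure_display)
    (Omega : measurableType disp) (R : realType) (P : probability Omega R)
    (f g : Omega -> R) :
  measurable_fun setT f -> measurable_fun setT g ->
  (forall w, 0 <= f w) -> (forall w, 0 <= g w) ->
  (forall A : set R, measurable A -> P (f @^-1` A) = P (g @^-1` A)) ->
  (\int[P]_w (f w)%:E = \int[P]_w (g w)%:E)%E.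
Proof.
move=> mf mg f0 g0 fgA.
pose X : {RV P >-> R} := HB.pack f (isMeasurableFun.Build _ _ _ _ _ mf).
pose Y : {RV P >-> R} := HB.pack g (isMeasurableFun.Build _ _ _ _ _ mg).
rewrite -(ge0_expectation_distribution (X := X) f0).
rewrite -(ge0_expectation_distribution (X := Y) g0).
by apply: eq_measure_integral => A mA _; exact: fgA.
Qed.

Lemma ge0_expectationD (disp : measure_display)
    (Omega : measurableType disp) (R : realType) (P : probability Omega R)
    (f g : Omega -> R) :
  measurable_fun setT f -> measurable_fun setT g ->
  (forall w, 0 <= f w) -> (forall w, 0 <= g w) ->
  (\int[P]_w (f w + g w)%:E = \int[P]_w (f w)%:E + \int[P]_w (g w)%:E)%E.
Proof.
move=> mf mg f0 g0; rewrite -ge0_integralD//.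
- by move=> w _; rewrite lee_fin.
- exact/measurable_EFinP.
- by move=> w _; rewrite lee_fin.
- exact/measurable_EFinP.
Qed.

(** * The Euclidean norm *)

Section EuclideanNorm.
Context (R : realType) (d : nat).
Implicit Types u v : 'rV[R]_d.

Lemma enorm_ge0 v : 0 <= enorm v.
Proof. exact: sqrtr_ge0. Qed.

Lemma enormN v : enorm (- v) = enorm v.
Proof. by congr Num.sqrt; apply: eq_bigr => i _; rewrite mxE sqrrN. Qed.

Lemma enormZ (c : R) v : 0 <= c -> enorm (c *: v) = c * enorm v.
Proof.
move=> c0; rewrite /enorm.
under eq_bigr do rewrite mxE exprMn.
by rewrite -mulr_sumr sqrtrM ?sqr_ge0// sqrtr_sqr ger0_norm.
Qed.

(** The triangle inequality, from the Cauchy-Schwarz inequality c <= |u| |v| for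
    the scalar product c; the latter holds because the quadratic form
    |s u + t v|^2 in (s, t) is nonnegative. *)
Lemma enormD u v : enorm (u + v) <= enorm u + enorm v.
Proof.
pose a := \sum_(i < d) u 0 i ^+ 2; pose b := \sum_(i < d) v 0 i ^+ 2.
pose c := \sum_(i < d) u 0 i * v 0 i.
have a0 : 0 <= a by apply: sumr_ge0 => i _; exact: sqr_ge0.
have b0 : 0 <= b by apply: sumr_ge0 => i _; exact: sqr_ge0.
have quad s t : 0 <= s ^+ 2 * a + 2 * (s * t) * c + t ^+ 2 * b.
  rewrite !mulr_sumr -!big_split /=; apply: sumr_ge0 => i _.
  rewrite (_ : _ + _ = (s * u 0 i + t * v 0 i) ^+ 2) ?sqr_ge0//; ring.
have cab : c <= Num.sqrt a * Num.sqrt b.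
  move: (sqr_sqrtr a0) (sqr_sqrtr b0) (sqrtr_ge0 a) (sqrtr_ge0 b).
  move: (Num.sqrt a) (Num.sqrt b) => p q pa qb p0 q0.
  have [c0|c0] := leP c 0; first by rewrite (le_trans c0)// mulr_ge0.
  (* When u = 0 and c > 0, the quadratic form takes the value -1 at
     (- (b + 1) / (2 c), 1); symmetrically when v = 0. *)
  have cK t : 2 * (- (t + 1) / (2 * c)) * c = - (t + 1).
    by field; rewrite gt_eqF.
  have [p_eq0|pN0] := eqVneq p 0.
    have := quad (- (b + 1) / (2 * c)) 1.
    by rewrite mulr1 cK -pa p_eq0; lra.
  have [q_eq0|qN0] := eqVneq q 0.
    have := quad 1 (- (a + 1) / (2 * c)).
    by rewrite mul1r cK -qb q_eq0; lra.
  have pq : 0 < p * q by rewrite mulr_gt0// lt0r ?pN0 ?qN0.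
  have := quad q (- p); rewrite -pa -qb.
  rewrite (_ : _ + _ = 2 * (p * q) * (p * q - c)); last by ring.
  by rewrite pmulr_rge0 ?subr_ge0// mulr_gt0.
rewrite -[leRHS]ger0_norm ?addr_ge0 ?enorm_ge0// -sqrtr_sqr ler_wsqrtr//.
rewrite sqrrD !sqr_sqrtr// -/a -/b.
have -> : \sum_(i < d) (u + v) 0 i ^+ 2 = a + c *+ 2 + b.
  rewrite -sumrMnl -!big_split /=; apply: eq_bigr => i _.
  by rewrite mxE sqrrD.
by rewrite lerD2r lerD2l lerMn2r.
Qed.

End EuclideanNorm.

(** * Nearest-neighbour distances *)

Section NearestDistance.
Context (R : realType) (d : nat).
Implicit Types (x y : nat -> 'rV[R]_d) (n k j : nat).

Lemma nearest_dist_ge0 x n k : 0 <= nearest_dist x n k.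
Proof.
rewrite /nearest_dist big_map.
apply: le_bigmin => [|j _]; last exact: enorm_ge0.
by case: [seq j <- _ | _] => //= j s; exact: enorm_ge0.
Qed.

Lemma nearest_dist_le x n k j : (1 <= j <= n)%N -> j != k ->
  nearest_dist x n k <= enorm (x k - x j).
Proof.
move=> jn jk; rewrite /nearest_dist.
apply: (@ge_bigmin_seq _ _ _ _ _ (enorm (x k - x j)) xpredT id) => //.
by apply: map_f; rewrite mem_filter jk mem_iota add1n ltnS.
Qed.

Lemma nearest_dist_attained x n k : (2 <= n)%N ->
  exists j,
    [/\ (1 <= j <= n)%N, j != k & nearest_dist x n k = enorm (x k - x j)].
Proof.
move=> n2; rewrite /nearest_dist; set s := [seq _ | j <- _ & _].
have sP : \big[Num.min/head 0 s]_(r <- s) r \in s.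
  have hs : head 0 s \in s.
    suff : (0 < size s)%N by case: s => //= a s _; rewrite mem_head.
    rewrite size_map size_filter -has_count; apply/hasP.
    have [->|k1] := eqVneq k 1%N.
      by exists 2%N; rewrite ?mem_iota ?add1n ?ltnS.
    by exists 1%N; rewrite ?mem_iota ?add1n ?ltnS 1?eq_sym// (leq_trans _ n2).
  rewrite big_seq; elim/big_ind : _ => // a b sa sb.
  by rewrite minElt; case: ifP.
have /mapP[j] := sP; rewrite mem_filter mem_iota add1n ltnS => /andP[jk jn] ->.
by exists j.
Qed.

Lemma nearest_distS x n k : (2 <= n)%N ->
  nearest_dist x n.+1 k <= nearest_dist x n k.
Proof.
move=> /(nearest_dist_attained x k)[j [/andP[j1 jn] jk ->]].
by apply: nearest_dist_le; rewrite ?j1 ?(leq_trans jn).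
Qed.

Lemma eq_nearest_dist x y n k : (1 <= k <= n)%N ->
  (forall j, (1 <= j <= n)%N -> x j = y j) ->
  nearest_dist x n k = nearest_dist y n k.
Proof.
move=> kn xy; rewrite /nearest_dist.
suff -> : [seq enorm (x k - x j) | j <- iota 1 n & j != k] =
          [seq enorm (y k - y j) | j <- iota 1 n & j != k] by [].
apply/eq_in_map => j; rewrite mem_filter mem_iota add1n ltnS => /andP[_ jn].
by rewrite !xy.
Qed.

(** Adding one particle at x p + D v, where D is the gap of x p: the distance
    D |v| between the new particle and x p bounds the gaps of both, and every
    old gap, in particular D, can only shrink. *)
Lemma sum_nearest_distS x n p v : (2 <= n)%N -> (1 <= p <= n)%N ->
  x n.+1 = x p + nearest_dist x n p *: v ->
  \sum_(1 <= k < n.+2) nearest_dist x n.+1 k + nearest_dist x n p <=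
  \sum_(1 <= k < n.+1) nearest_dist x n k +
  (nearest_dist x n p * Num.min (enorm v) 1 + nearest_dist x n p * enorm v).
Proof.
move=> n2 pn xn1; set D := nearest_dist x n p.
have D0 : 0 <= D := nearest_dist_ge0 _ _ _.
have [p1 pn'] := andP pn.
have xpn : enorm (x n.+1 - x p) = D * enorm v.
  by rewrite xn1 [x p + _]addrC addrK enormZ.
have new : nearest_dist x n.+1 n.+1 <= D * enorm v.
  rewrite -xpn; apply: nearest_dist_le; first by rewrite p1 leqW.
  by rewrite neq_ltn ltnS pn'.
have parent : nearest_dist x n.+1 p <= D * Num.min (enorm v) 1.
  rewrite minr_pMr// mulr1 le_min nearest_distS// andbT -xpn -enormN opprB.
  by apply: nearest_dist_le; rewrite ?ltnS ?leqnn// neq_ltn ltnS pn' orbT.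
rewrite big_nat_recr//= addrAC addrA lerD//.
have pin : p \in index_iota 1 n.+1 by rewrite mem_index_iota p1 ltnS.
rewrite (bigD1_seq p)//= ?iota_uniq// [leRHS]addrC.
rewrite [X in _ <= _ + X](bigD1_seq p)//= ?iota_uniq//.
rewrite -addrA lerD// addrC -/D lerD//.
by apply: ler_sum => k _; exact: nearest_distS.
Qed.

End NearestDistance.

(** * Measurability of norms, gaps and random selections *)

Section Measurability.
Context (R : realType) (d : nat).
Context (disp : measure_display) (T : measurableType disp).

Lemma measurable_enorm (v : T -> 'rV[R]_d) :
  (forall i, measurable_fun setT (fun w => v w 0 i)) ->
  measurable_fun setT (fun w => enorm (v w)).
Proof.
move=> mv; apply: (@measurableT_comp _ _ _ _ _ _ (@Num.sqrt R)).
  by apply: continuous_measurable_fun; exact: sqrt_continuous.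
by apply: measurable_sum => i; exact: measurable_funX.
Qed.

Lemma measurable_nearest_dist (x : nat -> T -> 'rV[R]_d) n k :
  (forall j i, (1 <= j <= n)%N -> measurable_fun setT (fun w => x j w 0 i)) ->
  (1 <= k <= n)%N ->
  measurable_fun setT (fun w => nearest_dist (fun j => x j w) n k).
Proof.
move=> mx kn; rewrite /nearest_dist.
under eq_fun do rewrite big_map.
have : forall j, j \in [seq j <- iota 1 n | j != k] -> (1 <= j <= n)%N.
  by move=> j; rewrite mem_filter mem_iota add1n ltnS => /andP[].
move: [seq _ <- _ | _] => s sn.
have mdist j : (1 <= j <= n)%N ->
    measurable_fun setT (fun w => enorm (x k w - x j w)).
  move=> jn; apply: measurable_enorm => i.
  by under eq_fun do rewrite !mxE; apply: measurable_funB; exact: mx.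
(* The default value of the minimum depends on the outcome, and it has to
   stay arbitrary for the induction on the list of neighbours. *)
have mmin (h : T -> R) : measurable_fun setT h ->
    measurable_fun setT
      (fun w => \big[Num.min/h w]_(j <- s) enorm (x k w - x j w)).
  move=> mh; elim: s sn => [|j s IHs] sn.
    by under eq_fun do rewrite big_nil.
  under eq_fun do rewrite big_cons.
  apply: measurable_minr; first by apply: mdist; apply: sn; rewrite mem_head.
  by apply: IHs => i si; apply: sn; rewrite in_cons si orbT.
apply: (mmin (fun w => head 0 [seq enorm (x k w - x j w) | j <- s])).
case: s sn {mmin} => [|j s] sn /=; first exact: measurable_cst.
by apply: mdist; apply: sn; rewrite mem_head.
Qed.

Lemma sum_indic_selection (c n : nat) (f : nat -> R) : (1 <= c <= n)%N ->
  \sum_(1 <= k < n.+1) (c == k)%:R * f k = f c.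
Proof.
move=> cn; rewrite (bigD1_seq c) ?iota_uniq ?mem_index_iota ?ltnS//=.
rewrite eqxx mul1r big1 ?addr0// => k /negbTE.
by rewrite eq_sym => ->; rewrite mul0r.
Qed.

Lemma measurable_selection (c : T -> nat) (f : nat -> T -> R) n :
  (forall w, 1 <= c w <= n)%N -> measurable_fun setT c ->
  (forall k, (1 <= k <= n)%N -> measurable_fun setT (f k)) ->
  measurable_fun setT (fun w => f (c w) w).
Proof.
move=> cn mc mf.
under eq_fun => w do
  rewrite -(@sum_indic_selection (c w) n (fun k => f k w))// big_add1 big_mkord.
apply: measurable_sum => i; apply: measurable_funM.
  exact: (@measurableT_comp _ _ _ _ _ _ (fun m => (m == i.+1)%:R : R)).
by apply: mf; rewrite /=.
Qed.

End Measurability.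

Section BorelVectors.
Context (R : realType) (d : nat).

Lemma measurable_coord (i : 'I_d) :
  measurable_fun [set: g_sigma_algebraType (@open 'rV[R]_d)]
    (fun v : 'rV[R]_d => v 0 i).
Proof.
apply: (measurability _ (RGenOpens.measurableE R)).
move=> _ [_ [a [b ->] <-]]; rewrite setTI; apply: sub_sigma_algebra.
apply: open_comp; last exact: interval_open.
by move=> v _; exact: coord_continuous.
Qed.

Lemma borel_coord (i : 'I_d) (B : set R) :
  measurable B -> borel [set v : 'rV[R]_d | B (v 0 i)].
Proof.
move=> mB; have := measurable_coord i measurableT mB.
by rewrite setTI.
Qed.

Lemma borel_enorm (B : set R) :
  measurable B -> borel [set v : 'rV[R]_d | B (enorm v)].
Proof.
move=> mB.
have := measurable_enorm (@measurable_coord) measurableT mB.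
by rewrite setTI.
Qed.

End BorelVectors.

(** * The past of the process *)

Section LisaHistory.
Context (disp : measure_display) (Omega : measurableType disp) (R : realType).
Context (P : probability Omega R) (d n0 : nat) (conf : 'I_n0 -> 'rV[R]_d).
Context (chi : nat -> Omega -> nat) (psi x : nat -> Omega -> 'rV[R]_d).
Hypothesis inputs : lisa_inputs P n0 chi psi.
Hypothesis process : lisa_process conf chi psi x.

Let chis := [set m | (n0 <= m)%N].
Let psis := [set m | (1 <= m)%N].
Let chi_field m := sigma_nat (chi m).
Let psi_field m := sigma_vec (psi m).

(** Only a generating family of the past: the sigma-algebra is
    <<s history a b >>.  The particles x_1, ..., x_n are determined by the chi_m
    with m < n and the psi_m with m <= n, that is by a = b = n, and the parent
    of x_{n+1} by one more chi, that is by a = n + 1 and b = n. *)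
Definition history (a b : nat) : set_system Omega :=
  sigma_join [set m | (n0 <= m < a)%N] (fun m => sigma_nat (chi m)) `|`
  sigma_join [set m | (1 <= m <= b)%N] (fun m => sigma_vec (psi m)).

Let chi_field_sigma m : sigma_algebra setT (chi_field m).
Proof. by apply: sigma_algebra_preimage; exact: sigma_algebra_measurable. Qed.

Let psi_field_sigma m : sigma_algebra setT (psi_field m).
Proof. by apply: sigma_algebra_preimage; exact: smallest_sigma_algebra. Qed.

Let chi_field_measurable m : chis m -> chi_field m `<=` measurable.
Proof. by move=> nm _ [B mB <-]; exact: (chi_measurable inputs nm). Qed.

Let psi_field_measurable m : psis m -> psi_field m `<=` measurable.
Proof.
by move=> m1 _ [B mB <-]; rewrite setTI; exact: (psi_measurable inputs m1).
Qed.

Let join_measurable I F : (forall m, I m -> F m `<=` @measurable _ Omega) ->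
  sigma_join I F `<=` measurable.
Proof.
move=> mF; apply: smallest_sub; first exact: sigma_algebra_measurable.
by move=> A [m Im]; exact: mF.
Qed.

Let join_sub I J (F : nat -> set_system Omega) :
  I `<=` J -> sigma_join I F `<=` sigma_join J F.
Proof.
move=> IJ; apply: smallest_sub; first exact: smallest_sigma_algebra.
by move=> A [m Im FA]; apply: sub_sigma_algebra; exists m => //; exact: IJ.
Qed.

Let join_ge I (F : nat -> set_system Omega) m : I m -> F m `<=` sigma_join I F.
Proof. by move=> Im A FA; apply: sub_sigma_algebra; exists m. Qed.

Let join_sigma I (F : nat -> set_system Omega) :
  sigma_algebra setT (sigma_join I F).
Proof. exact: smallest_sigma_algebra. Qed.

Lemma history_sub_measurable a b : <<s history a b >> `<=` measurable.
Proof.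
apply: smallest_sub; first exact: sigma_algebra_measurable.
move=> A [] /join_measurable; apply => m /=.
- by case/andP => nm _; exact: chi_field_measurable.
- by case/andP => m1 _; exact: psi_field_measurable.
Qed.

(** The earlier chi are independent of chi_n, and the psi are independent of all
    the chi together. *)
Lemma independent_history_chi n : (n0 <= n)%N ->
  independent2 P <<s history n n >> (sigma_nat (chi n)).
Proof.
move=> nn0; apply: (@independent2_join_left _ _ _ _
    (sigma_join chis chi_field) _ (sigma_join psis psi_field)) => //.
- exact: join_measurable.
- exact: join_measurable.
- exact: sigma_algebra_setI_closed.
- by apply: join_sub => m /andP[].
- exact: join_ge.
- by apply: join_sub => m /andP[].
- exact: (chi_psi_independent inputs).
- apply: (independent2_sigma_join _ chi_field_measurable) => //.
  + exact: (chi_independent inputs).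
  + by move=> m /andP[].
  + by rewrite /= ltnn andbF.
Qed.

(** As for chi_n, with the roles of the two input sequences exchanged: the chi,
    this time including chi_n, are the independent extra information. *)
Lemma independent_history_psi n :
  independent2 P <<s history n.+1 n >> (sigma_vec (psi n.+1)).
Proof.
rewrite /history setUC; apply: (@independent2_join_left _ _ _ _
    (sigma_join psis psi_field) _ (sigma_join chis chi_field)) => //.
- exact: join_measurable.
- exact: join_measurable.
- exact: sigma_algebra_setI_closed.
- by apply: join_sub => m /andP[].
- exact: join_ge.
- by apply: join_sub => m /andP[].
- move=> A B FA FB.
  by rewrite setIC muleC (chi_psi_independent inputs).
- apply: (independent2_sigma_join _ psi_field_measurable) => //.
  + exact: (psi_independent inputs).
  + by move=> m /andP[].
  + by rewrite /= ltnn.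
Qed.

Lemma measurable_chi_history a b m : (n0 <= m < a)%N ->
  measurable_fun [set: g_sigma_algebraType (history a b)] (chi m).
Proof.
move=> ma _ B mB; apply: sub_sigma_algebra; left.
by apply: (join_ge (m := m)) => //; exists B.
Qed.

Lemma measurable_psi_history a b m i : (1 <= m <= b)%N ->
  measurable_fun [set: g_sigma_algebraType (history a b)]
    (fun w => psi m w 0 i).
Proof.
move=> mb _ B mB; apply: sub_sigma_algebra; right.
apply: (join_ge (m := m)) => //.
by exists [set v | B (v 0 i)] => //; exact: borel_coord.
Qed.

(** Strong induction on k: by the recursion, x_{k+1} is a measurable function of
    x_1, ..., x_k, chi_k and psi_{k+1}. *)
Lemma measurable_position_history a b k i : (1 <= k <= a)%N -> (k <= b)%N ->
  measurable_fun [set: g_sigma_algebraType (history a b)] (fun w => x k w 0 i).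
Proof.
elim/ltn_ind : k i => -[//|k] IHk i /andP[_ ka] kb.
have [kn0|n0k] := ltnP k n0.
  under eq_fun do rewrite (lisa_initial process (Ordinal kn0)).
  exact: measurable_cst.
under eq_fun do rewrite (lisa_step process)// !mxE.
have mchi : measurable_fun [set: g_sigma_algebraType (history a b)] (chi k).
  by apply: measurable_chi_history; rewrite n0k.
have IHx j i' : (1 <= j <= k)%N ->
    measurable_fun [set: g_sigma_algebraType (history a b)]
      (fun w => x j w 0 i').
  move=> /andP[j1 jk]; apply: IHk; rewrite ?ltnS ?j1//.
    by rewrite (leq_trans jk)// ltnW.
  by rewrite (leq_trans jk)// ltnW.
have chik w := chi_range inputs w n0k.
apply: measurable_funD.
  apply: (@measurable_selection R _ (g_sigma_algebraType (history a b)) (chi k)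
    (fun j w => x j w 0 i) k chik) => // j jk.
  exact: IHx.
apply: measurable_funM; last by apply: measurable_psi_history.
apply: (@measurable_selection R _ (g_sigma_algebraType (history a b)) (chi k)
  (fun j w => nearest_dist (fun j => x j w) k j) k chik) => // j jk.
by apply: measurable_nearest_dist => // l i' lk; exact: IHx.
Qed.

Lemma measurable_nearest_dist_history a n k : (n <= a)%N -> (1 <= k <= n)%N ->
  measurable_fun [set: g_sigma_algebraType (history a n)]
    (fun w => nearest_dist (fun j => x j w) n k).
Proof.
move=> na kn; apply: measurable_nearest_dist => // j i /andP[j1 jn].
by apply: measurable_position_history => //; rewrite j1 (leq_trans jn).
Qed.

Lemma measurable_parent_dist_history n : (n0 <= n)%N ->
  measurable_fun [set: g_sigma_algebraType (history n.+1 n)]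
    (fun w => nearest_dist (fun j => x j w) n (chi n w)).
Proof.
move=> n0n; have chin w := chi_range inputs w n0n.
apply: (@measurable_selection R _ (g_sigma_algebraType (history n.+1 n)) (chi n)
  (fun k w => nearest_dist (fun j => x j w) n k) n chin).
  by apply: measurable_chi_history; rewrite n0n /=.
by move=> k kn; exact: measurable_nearest_dist_history.
Qed.

Lemma measurable_of_history a b (f : Omega -> R) :
  measurable_fun [set: g_sigma_algebraType (history a b)] f ->
  measurable_fun [set: Omega] f.
Proof.
move=> mf _ B mB; apply: (@history_sub_measurable a b).
exact: (mf measurableT).
Qed.

End LisaHistory.

(** * Expected gaps and displacements *)

Section LisaExpectations.
Context (disp : measure_display) (Omega : measurableType disp) (R : realType).
Context (P : probability Omega R) (d n0 : nat) (conf : 'I_n0 -> 'rV[R]_d).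
Context (chi : nat -> Omega -> nat) (psi x : nat -> Omega -> 'rV[R]_d).
Hypothesis inputs : lisa_inputs P n0 chi psi.
Hypothesis process : lisa_process conf chi psi x.
Hypothesis n0_ge2 : (2 <= n0)%N.

Definition gap n k w := nearest_dist (fun j => x j w) n k.
Definition parent_gap n w := gap n (chi n w) w.
Definition total_gap n w := \sum_(1 <= k < n.+1) gap n k w.

Let gap_ge0 n k w : 0 <= gap n k w. Proof. exact: nearest_dist_ge0. Qed.

Lemma parent_gap_ge0 n w : 0 <= parent_gap n w. Proof. exact: gap_ge0. Qed.

Lemma total_gap_ge0 n w : 0 <= total_gap n w.
Proof. by rewrite /total_gap sumr_ge0. Qed.

Let measurable_gap n k : (1 <= k <= n)%N -> measurable_fun setT (gap n k).
Proof.
move=> kn; apply: (measurable_of_history inputs (a := n) (b := n)).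
exact: (measurable_nearest_dist_history inputs process).
Qed.

Lemma measurable_parent_gap n : (n0 <= n)%N ->
  measurable_fun setT (parent_gap n).
Proof.
move=> n0n; apply: (measurable_of_history inputs (a := n.+1) (b := n)).
exact: (measurable_parent_dist_history inputs process).
Qed.

Lemma measurable_total_gap n : measurable_fun setT (total_gap n).
Proof.
rewrite /total_gap; under eq_fun do rewrite big_add1 big_mkord.
by apply: measurable_sum => i; apply: measurable_gap; rewrite /= ltn_ord.
Qed.

Lemma measurable_position k i : (1 <= k)%N ->
  measurable_fun setT (fun w => x k w 0 i).
Proof.
move=> k1; apply: (measurable_of_history inputs (a := k) (b := k)).
by apply: (measurable_position_history inputs process); rewrite ?k1 /=.
Qed.

Let measurable_step_fun (h : 'rV[R]_d -> R) m :
  (forall B : set R, measurable B -> borel [set v | B (h v)]) -> (1 <= m)%N ->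
  measurable_fun setT (fun w => h (psi m w)).
Proof.
move=> mh m1 _ B mB; rewrite setTI.
exact: (psi_measurable inputs m1 (mh _ mB)).
Qed.

(** D_n is the sum over k of the gap of x_k times the indicator of chi_n = k,
    which is independent of that gap and has mean 1/n. *)
Lemma expected_parent_gap n : (n0 <= n)%N ->
  (\int[P]_w (parent_gap n w)%:E =
   (n%:R^-1)%:E * \int[P]_w (total_gap n w)%:E)%E.
Proof.
move=> n0n; have chin w := chi_range inputs w n0n.
pose hit k w : R := (chi n w == k)%:R.
have hitE k : hit k = \1_[set w | chi n w = k].
  apply/funext => w; rewrite indicE /hit; congr (nat_of_bool _)%:R.
  by apply/idP/idP => [/eqP e|]; rewrite inE//= => ->.
have mhit_set k : measurable [set w | chi n w = k].
  have mchi := chi_measurable inputs n0n.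
  by rewrite -[X in measurable X]setTI; exact: (mchi measurableT [set k]).
have mhit k : measurable_fun setT (hit k).
  by rewrite hitE; exact: measurable_indic.
transitivity (\int[P]_w \sum_(i < n) (hit i.+1 w * gap n i.+1 w)%:E)%E.
  apply: eq_integral => w _; rewrite sumEFin; congr EFin.
  rewrite /parent_gap.
  rewrite -(@sum_indic_selection R (chi n w) n (fun k => gap n k w))//.
  by rewrite big_add1 big_mkord.
rewrite ge0_integral_sum//; first last.
- by move=> i w _; rewrite lee_fin mulr_ge0.
- move=> i; apply/measurable_EFinP/measurable_funM => //.
  by apply: measurable_gap; rewrite /= ltn_ord.
transitivity (\sum_(i < n) (n%:R^-1)%:E * \int[P]_w (gap n i.+1 w)%:E)%E.
  apply: eq_bigr => i _.
  have i_n : (1 <= i.+1 <= n)%N by rewrite /= ltn_ord.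
  under eq_integral do rewrite mulrC.
  rewrite ge0_expectationM_indep//; last 2 first.
  - exact: measurable_gap.
  - move=> A B mA mB; apply: (independent_history_chi inputs n0n).
      have mgap := measurable_nearest_dist_history inputs process (leqnn n) i_n.
      have := mgap measurableT _ mA.
      by rewrite setTI.
    by exists [set m | B (m == i.+1)%:R] => //; rewrite setTI.
  rewrite muleC; congr (_ * _)%E.
  rewrite -(chi_uniform inputs n0n i_n) -[in RHS](setIT [set w | _]).
  by rewrite -integral_indic// -hitE.
rewrite -ge0_sume_distrr//; last first.
  by move=> i _; apply: integral_ge0 => w _; rewrite lee_fin.
congr (_ * _)%E; rewrite -ge0_integral_sum//; first last.
- by move=> i w _; rewrite lee_fin.
- by move=> i; apply/measurable_EFinP/measurable_gap; rewrite /= ltn_ord.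
apply: eq_integral => w _; rewrite sumEFin; congr EFin.
by rewrite /total_gap big_add1 big_mkord.
Qed.

(** D_n is a function of the past and of chi_n, which are jointly independent of
    psi_{n+1}; and psi_{n+1} has the law of psi_1. *)
Lemma expected_parent_gapM (h : 'rV[R]_d -> R) n :
  (forall v, 0 <= h v) ->
  (forall B : set R, measurable B -> borel [set v | B (h v)]) ->
  (n0 <= n)%N ->
  (\int[P]_w (parent_gap n w * h (psi n.+1 w))%:E =
   \int[P]_w (parent_gap n w)%:E * \int[P]_w (h (psi 1%N w))%:E)%E.
Proof.
move=> h0 mh n0n; rewrite ge0_expectationM_indep//; last 4 first.
- exact: measurable_parent_gap.
- exact: measurable_step_fun.
- exact: parent_gap_ge0.
- move=> A B mA mB; apply: (independent_history_psi inputs).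
    have := measurable_parent_dist_history inputs process n0n measurableT mA.
    by rewrite setTI; exact.
  by exists [set v | B (h v)]; [exact: mh|rewrite setTI].
congr (_ * _)%E; apply: ge0_expectation_same_law => //.
- exact: measurable_step_fun.
- exact: measurable_step_fun.
- by move=> A mA; exact: (psi_identically_distributed inputs _ (mh _ mA)).
Qed.

Variables (c c_hat start : R).
Hypothesis mean_eta : (\int[P]_w (enorm (psi 1%N w))%:E = c%:E)%E.
Hypothesis mean_eta_hat :
  (\int[P]_w (Num.min (enorm (psi 1%N w)) 1)%:E = c_hat%:E)%E.
Hypothesis subcritical : c + c_hat < 1.
Hypothesis total_gap_start : forall w, total_gap n0 w = start.

Let eta_ge0 (v : 'rV[R]_d) : 0 <= enorm v. Proof. exact: enorm_ge0. Qed.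

Let eta_hat_ge0 (v : 'rV[R]_d) : 0 <= Num.min (enorm v) 1.
Proof. by rewrite le_min enorm_ge0 ler01. Qed.

Let borel_eta_hat (B : set R) : measurable B ->
  borel [set v : 'rV[R]_d | B (Num.min (enorm v) 1)].
Proof.
move=> mB; apply: (@borel_enorm R d [set r | B (Num.min r 1)]).
have mmin : measurable_fun [set: R] (fun r : R => Num.min r 1).
  exact: measurable_minr.
by rewrite -[X in measurable X]setTI; exact: (mmin measurableT B mB).
Qed.

Let c_ge0 : 0 <= c.
Proof.
by rewrite -lee_fin -mean_eta integral_ge0// => w _; rewrite lee_fin.
Qed.

Let c_hat_ge0 : 0 <= c_hat.
Proof.
by rewrite -lee_fin -mean_eta_hat integral_ge0// => w _; rewrite lee_fin.
Qed.

Let q := 1 - c_hat - c.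

Let q_gt0 : 0 < q.
Proof. by rewrite /q -addrA -opprD subr_gt0 addrC. Qed.

Lemma total_gap_step n w : (n0 <= n)%N ->
  total_gap n.+1 w + parent_gap n w <=
  total_gap n w + (parent_gap n w * Num.min (enorm (psi n.+1 w)) 1 +
                   parent_gap n w * enorm (psi n.+1 w)).
Proof.
move=> n0n; apply: (sum_nearest_distS (x := fun j => x j w)).
- exact: leq_trans n0n.
- exact: (chi_range inputs w n0n).
- exact: (lisa_step process w n0n).
Qed.

Lemma expected_total_gap_step n : (n0 <= n)%N ->
  (\int[P]_w (total_gap n.+1 w)%:E + \int[P]_w (parent_gap n w)%:E <=
   \int[P]_w (total_gap n w)%:E +
   \int[P]_w (parent_gap n w)%:E * (c_hat + c)%:E)%E.
Proof.
move=> n0n.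
have mp := measurable_parent_gap n0n.
have mt := measurable_total_gap.
have meta := measurable_step_fun (@borel_enorm R d) (ltn0Sn n).
have metah := measurable_step_fun borel_eta_hat (ltn0Sn n).
have p0 := parent_gap_ge0; have t0 := total_gap_ge0.
rewrite EFinD ge0_muleDr ?lee_fin// -mean_eta -mean_eta_hat.
rewrite -(expected_parent_gapM eta_hat_ge0)//.
rewrite -(expected_parent_gapM eta_ge0)//; last exact: borel_enorm.
have mp_eta := measurable_funM mp meta.
have mp_eta_hat := measurable_funM mp metah.
have p_eta0 w : 0 <= parent_gap n w * enorm (psi n.+1 w) by rewrite mulr_ge0.
have p_eta_hat0 w : 0 <= parent_gap n w * Num.min (enorm (psi n.+1 w)) 1.
  by rewrite mulr_ge0.
rewrite -(ge0_expectationD P (mt n.+1) mp (t0 n.+1) (p0 n)).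
rewrite -(ge0_expectationD P mp_eta_hat mp_eta p_eta_hat0 p_eta0).
rewrite -(ge0_expectationD P (mt n) (measurable_funD mp_eta_hat mp_eta) (t0 n)
  (fun w => addr_ge0 (p_eta_hat0 w) (p_eta0 w))).
apply: ge0_le_integral => //.
- by move=> w _; rewrite lee_fin addr_ge0.
- by apply/measurable_EFinP/measurable_funD.
- by apply/measurable_EFinP/measurable_funD => //; exact: measurable_funD.
- by move=> w _; rewrite lee_fin total_gap_step.
Qed.

Let a n : R := fine (\int[P]_w (total_gap n w)%:E)%E.

Let a_ge0 n : 0 <= a n.
Proof.
by apply: fine_ge0; apply: integral_ge0 => w _; rewrite lee_fin total_gap_ge0.
Qed.

Let a_start : a n0 = start.
Proof.
rewrite /a; under eq_integral do rewrite total_gap_start.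
by rewrite integral_cst//= probability_setT mule1.
Qed.

(** Finiteness propagates from the constant S_{n_0}: the right-hand side of the
    expected step inequality involves only E S_n and E D_n = E S_n / n. *)
Lemma expected_total_gap_fin n : (n0 <= n)%N ->
  (\int[P]_w (total_gap n w)%:E = (a n)%:E)%E.
Proof.
move=> n0n; rewrite -(subnKC n0n); elim: (n - n0)%N => [|j IHj].
  rewrite addn0 a_start; under eq_integral do rewrite total_gap_start.
  by rewrite integral_cst//= probability_setT mule1.
rewrite addnS /a fineK// ge0_fin_numE; last first.
  by apply: integral_ge0 => w _; rewrite lee_fin total_gap_ge0.
have := expected_total_gap_step (leq_addr j n0).
rewrite expected_parent_gap ?leq_addr// IHj -!EFinM -EFinD => step.
apply: le_lt_trans (ltry _); apply: le_trans step.
by rewrite leeDl// lee_fin mulr_ge0 ?invr_ge0.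
Qed.

(** The telescoped form of (1 - C^ - C) E S_n / n <= E S_n - E S_{n+1}. *)
Lemma sum_expected_gap N :
  a (n0 + N) + q * \sum_(0 <= j < N) (n0 + j)%:R^-1 * a (n0 + j) <= start.
Proof.
elim: N => [|N IHN]; first by rewrite big_nil mulr0 addr0 addn0 a_start.
rewrite big_nat_recr//= addnS.
have := expected_total_gap_step (leq_addr N n0).
rewrite expected_parent_gap ?leq_addr// !expected_total_gap_fin ?leq_addr//;
  last by rewrite leqW ?leq_addr.
rewrite -!EFinM -!EFinD lee_fin => step; apply: le_trans IHN.
move: step; rewrite /q; nra.
Qed.

Lemma sum_expected_displacement N :
  (\sum_(0 <= j < N) \int[P]_w
    (parent_gap (n0 + j) w * enorm (psi (n0 + j).+1 w))%:E
   <= (start * c / q)%:E)%E.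
Proof.
under eq_bigr => j _.
  rewrite (expected_parent_gapM eta_ge0 (@borel_enorm R d) (leq_addr j n0)).
  rewrite expected_parent_gap ?leq_addr// expected_total_gap_fin ?leq_addr//.
  rewrite mean_eta -!EFinM; over.
rewrite sumEFin lee_fin -mulr_suml mulrAC ler_wpM2r//.
by rewrite ler_pdivlMr// mulrC (le_trans _ (sum_expected_gap N))// lerDr.
Qed.

(** A particle placed at step n0 + N is within D eta of its parent, which is
    among the earlier particles. *)
Lemma enorm_position_le (A0 : R) N k w :
  (forall i, enorm (conf i) <= A0) -> (1 <= k <= n0 + N)%N ->
  enorm (x k w) <= A0 + \sum_(0 <= j < N)
    parent_gap (n0 + j) w * enorm (psi (n0 + j).+1 w).
Proof.
move=> confA0; elim: N k => [|N IHN] [|k]//.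
  rewrite addn0 big_nil addr0 => /= kn0.
  by rewrite (lisa_initial process (Ordinal kn0)).
have incr_ge0 : 0 <= parent_gap (n0 + N) w * enorm (psi (n0 + N).+1 w).
  by rewrite mulr_ge0 ?parent_gap_ge0 ?enorm_ge0.
rewrite big_nat_recr//= addrA addnS ltnS leq_eqVlt => /predU1P[->|kn].
  rewrite (lisa_step process)// ?leq_addr//.
  apply: le_trans (enormD _ _) _; rewrite (enormZ _ (nearest_dist_ge0 _ _ _)).
  by rewrite lerD// IHN// (chi_range inputs) ?leq_addr.
by apply: le_trans (IHN k.+1 kn) _; rewrite lerDl.
Qed.

(** The integrable random variable dominating the supremum is V, the sum of A0
    and of all displacements. *)
Lemma expected_sup_norm (A0 : R) : (forall i, enorm (conf i) <= A0) ->
  {ae P, forall w, (sup_norm x w < +oo)%E} /\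
  (\int[P]_w sup_norm x w <= (A0 + start * c / q)%:E)%E.
Proof.
move=> confA0.
pose g j w : \bar R :=
  (parent_gap (n0 + j) w * enorm (psi (n0 + j).+1 w))%:E.
have g0 j w : (0 <= g j w)%E.
  by rewrite lee_fin mulr_ge0 ?parent_gap_ge0 ?enorm_ge0.
have mg j : measurable_fun setT (g j).
  apply/measurable_EFinP/measurable_funM.
    by apply: measurable_parent_gap; exact: leq_addr.
  exact: measurable_step_fun (@borel_enorm R d) _.
have A0_ge0 : 0 <= A0.
  by apply: le_trans (confA0 (Ordinal n0_ge2)); exact: enorm_ge0.
pose V w := (A0%:E + \sum_(0 <= j <oo) g j w)%E.
have sum_g0 w : (0 <= \sum_(0 <= j <oo) g j w)%E by exact: nneseries_ge0.
have mV : measurable_fun setT V.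
  apply: emeasurable_funD => //.
  exact: ge0_emeasurable_sum.
have V0 w : (0 <= V w)%E by rewrite adde_ge0.
have supV w : (sup_norm x w <= V w)%E.
  apply: ub_ereal_sup => _ [k /= k1 <-].
  apply: le_trans (_ : _ <= A0%:E + \sum_(0 <= j < k) g j w)%E _.
    rewrite sumEFin -EFinD lee_fin enorm_position_le// k1/= leq_addl//.
  by rewrite leeD2l// nneseries_lim_ge.
have IV : (\int[P]_w V w <= (A0 + start * c / q)%:E)%E.
  rewrite ge0_integralD//; last exact: ge0_emeasurable_sum.
  rewrite integral_cst//= probability_setT mule1 EFinD leeD2l//.
  rewrite integral_nneseries//; apply: lime_le.
    by apply: is_cvg_nneseries => j _ _; exact: integral_ge0.
  by apply: nearW => N; exact: sum_expected_displacement.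
have sup0 w : (0 <= sup_norm x w)%E.
  apply: (@le_trans _ _ (enorm (x 1%N w))%:E).
    by rewrite lee_fin enorm_ge0.
  by apply: ereal_sup_ubound; exists 1%N.
have msup : measurable_fun setT (sup_norm x).
  (* x 0 is not part of the process and need not be measurable, hence the shift
     of the index. *)
  pose u n w := (enorm (x n.+1 w))%:E.
  have -> : sup_norm x = fun w => esups (u^~ w) 0.
    apply/funext => w; congr ereal_sup; apply/seteqP; split=> _ [n /= n1 <-].
      by exists n.-1 => //; rewrite /u prednK.
    by exists n.+1.
  apply: measurable_fun_esups => n; apply/measurable_EFinP.
  by apply: measurable_enorm => i; exact: measurable_position.
split; last by apply: le_trans IV; exact: ge0_le_integral.
have : P.-integrable setT V.
  apply/integrableP; split => //.
  under eq_integral do rewrite gee0_abs//.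
  by apply: le_lt_trans IV _; exact: ltry.
move=> /(integrable_ae measurableT); apply: filterS => w /(_ Logic.I) Vfin.
by apply: le_lt_trans (supV w) _; rewrite ltey_eq Vfin.
Qed.

End LisaExpectations.

(** * The bound on the supremum *)

Theorem theorem2 (R : realType) (d n0 : nat) (conf : 'I_n0 -> 'rV[R]_d) :
  (1 <= d)%N -> (2 <= n0)%N -> injective conf ->
  exists A0 D0 : R,
  forall (disp : measure_display) (Omega : measurableType disp)
    (P : probability Omega R)
    (chi : nat -> Omega -> nat) (psi x : nat -> Omega -> 'rV[R]_d),
  lisa_inputs P n0 chi psi ->
  lisa_process conf chi psi x ->
  let eta n w := enorm (psi n w) in
  let eta_hat n w := Num.min (eta n w) 1 in
  let C := ('E_P[eta 1%N])%E in
  let C_hat := ('E_P[eta_hat 1%N])%E in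
  (C + C_hat < 1)%E ->
  {ae P, forall w, (sup_norm x w < +oo)%E} /\
  (\int[P]_w sup_norm x w <=
     (A0 + n0%:R * D0 * fine C / (1 - fine C_hat - fine C))%:E)%E.
Proof.
move=> _ n0_ge2 _.
(* The initial configuration indexed from 1, as the process is. *)
pose y j : 'rV[R]_d := if insub j.-1 is Some i then conf i else 0.
pose start := \sum_(1 <= k < n0.+1) nearest_dist y n0 k.
exists (\sum_i enorm (conf i)), (start / n0%:R).
move=> disp Omega P chi psi x inputs process eta eta_hat C C_hat CC1.
have CE : C = (\int[P]_w (enorm (psi 1%N w))%:E)%E by rewrite /C unlock.
have C_hatE : C_hat = (\int[P]_w (Num.min (enorm (psi 1%N w)) 1)%:E)%E.
  by rewrite /C_hat unlock.
have C0 : (0 <= C)%E.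
  by rewrite CE integral_ge0// => w _; rewrite lee_fin enorm_ge0.
have C_hat0 : (0 <= C_hat)%E.
  rewrite C_hatE integral_ge0// => w _.
  by rewrite lee_fin le_min enorm_ge0 ler01.
have Cfin : C \is a fin_num.
  rewrite ge0_fin_numE// (le_lt_trans _ (lt_trans CC1 (ltry 1)))//.
  by rewrite leeDl.
have C_hatfin : C_hat \is a fin_num.
  rewrite ge0_fin_numE// (le_lt_trans _ (lt_trans CC1 (ltry 1)))//.
  by rewrite leeDr.
have startE w : total_gap x n0 w = start.
  apply: eq_big_nat => k kn; apply: eq_nearest_dist => // -[//|j] jn.
  by rewrite (lisa_initial process (Ordinal jn)) /y/= insubT.
have -> : n0%:R * (start / n0%:R) = start.
  by rewrite mulrC divfK// pnatr_eq0 -lt0n (leq_trans _ n0_ge2).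
apply: (expected_sup_norm inputs process n0_ge2 _ _ _ startE).
- by rewrite -CE fineK.
- by rewrite -C_hatE fineK.
- by rewrite -lte_fin EFinD !fineK.
- by move=> i; rewrite (bigD1 i)//= lerDl sumr_ge0// => j _; exact: enorm_ge0.
Qed.
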